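(* Let $g,f_1,f_2:\mathbb{R}^2\times\mathbb{R}\to\mathbb{R}$ be smooth functions of $(x,y,\alpha)$ and consider the two-dimensional quasilinear differential-algebraic system $$g(x,y,\alpha)\,\dot x=f_1(x,y,\alpha),\qquad \dot y=f_2(x,y,\alpha).$$ Assume that $M=(0,0)$ is a singular saddle-node point of type II at $\alpha=0$, i.e. $g=f_1=f_2=0$ at $(0,0,0)$, and that at $(x,y,\alpha)=(0,0,0)$ $$f_{1x}\neq0,\quad g_x\neq0,\quad \det\frac{\partial(f_1,f_2)}{\partial(x,y)}\neq0,\quad \det\frac{\partial(f_1,g)}{\partial(x,y)}\neq0,\quad \det\frac{\partial(f_1,f_2,g)}{\partial(x,y,\alpha)}\neq0 .$$ Then for small $\alpha\neq0$ the point $M$ splits into a pair of structurally stable points: there are a neighbourhood $U$ of $M$ and $\alpha_0>0$ such that for every $\alpha$ with $0<|\alpha|<\alpha_0$ the system has in $U$ exactly one equilibrium and exactly one singular equilibrium, both simple (and both tending to $M$ as $\alpha\to0$). Moreover, they are either a saddle (equilibrium) and a folded node (singular equilibrium), or a node (equilibrium) and a folded saddle (singular equilibrium).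
   Context: Subscripts $x,y$ denote partial derivatives. The desingularized system is the ODE $\dot x=f_1$, $\dot y=f_2\,g$. Equilibrium: a point with $f_1=f_2=0$, $g\neq0$. It is simple if the linearization matrix of the desingularized system there, $A_{EQ}=\begin{pmatrix}f_{1x}&f_{1y}\\ gf_{2x}&gf_{2y}\end{pmatrix}$, has no eigenvalues on the imaginary axis. It is a saddle if the eigenvalues $\lambda_1,\lambda_2$ of $A_{EQ}$ are real with $\lambda_1\lambda_2<0$, and a node if they are real with $\lambda_1\lambda_2>0$. Singular equilibrium: a point with $g=f_1=0$. It is simple if there $f_2\neq0$, $g_x\neq0$, $\det\frac{\partial(f_1,g)}{\partial(x,y)}\neq0$, and the linearization matrix of the desingularized system, $A_{sEQ}=\begin{pmatrix}f_{1x}&f_{1y}\\ g_xf_2&g_yf_2\end{pmatrix}$, has no eigenvalues on the imaginary axis. A simple singular equilibrium is a folded node if the eigenvalues $\lambda_1,\lambda_2$ of $A_{sEQ}$ are real with $\lambda_1\lambda_2>0$, and a folded saddle if they are real with $\lambda_1\lambda_2<0$. ''Structurally stable'' means: for the equilibrium, that it is a simple equilibrium ($A_{EQ}$ has no eigenvalues on the imaginary axis); for the singular equilibrium, that it is a simple singular equilibrium ($f_2\neq0$, $g_x\neq0$, $\det\frac{\partial(f_1,g)}{\partial(x,y)}\neq0$, and $A_{sEQ}$ has no eigenvalues on the imaginary axis). *)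

(* Defs.v *)
From HB Require Import structures.
From mathcomp Require Import all_boot all_order all_algebra.
From mathcomp Require Import all_classical all_reals all_analysis.
From mathcomp Require Import complex.

Set Implicit Arguments.
Unset Strict Implicit.
Unset Printing Implicit Defensive.

Import Order.TTheory GRing.Theory Num.Theory.
Import numFieldNormedType.Exports.

Local Open Scope classical_set_scope.
Local Open Scope ring_scope.

(* R^2 x R is represented by R * R * R, with (x, y, alpha) = ((x, y), alpha),
   so that (z, alpha) with z : R * R is a point of it. *)
Definition dirx (R : realType) : R * R * R := (1, 0, 0).
Definition diry (R : realType) : R * R * R := (0, 1, 0).
Definition dira (R : realType) : R * R * R := (0, 0, 1).

(* Joint regularity in (x, y, alpha): Frechet differentiable everywhere, with
   all directional derivatives again of class C^j. *)
Fixpoint Ck (R : realType) (k : nat) (f : R * R * R -> R) : Prop :=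
  if k is j.+1 then
    (forall p, differentiable f p) /\ (forall v, Ck j (fun p => 'D_v f p))
  else continuous f.

Definition smooth (R : realType) (f : R * R * R -> R) : Prop :=
  forall k, Ck k f.

(* The matrix d(fs)/d(vs): row i differentiates the i-th function. *)
Definition jacmx (R : realType) (n : nat) (fs : n.-tuple (R * R * R -> R))
    (vs : n.-tuple (R * R * R)) (p : R * R * R) : 'M[R]_n :=
  \matrix_(i < n, j < n) 'D_(tnth vs j) (tnth fs i) p.

(* Right-hand side of x' = f1, y' = f2 g. *)
Definition desingularized (R : realType) (g f1 f2 : R * R * R -> R) :
  2.-tuple (R * R * R -> R) := [tuple f1; (fun p => f2 p * g p)].

Definition linearization (R : realType) (g f1 f2 : R * R * R -> R)
    (p : R * R * R) : 'M[R]_2 :=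
  jacmx (desingularized g f1 f2) [tuple dirx R; diry R] p.

Definition no_imaginary_eigenvalue (R : realType) (n : nat) (A : 'M[R]_n) :
    Prop :=
  forall l : R[i],
    eigenvalue (map_mx (real_complex R) A) l -> complex.Re l != 0.

(* l1 and l2 are the eigenvalues of A, listed with multiplicity, and both are
   real. *)
Definition real_eigenvalues (R : realType) (A : 'M[R]_2) (l1 l2 : R) : Prop :=
  char_poly A = ('X - l1%:P) * ('X - l2%:P).

Definition equilibrium (R : realType) (g f1 f2 : R * R * R -> R)
    (p : R * R * R) : Prop :=
  [/\ f1 p = 0, f2 p = 0 & g p != 0].

Definition simple_equilibrium (R : realType) (g f1 f2 : R * R * R -> R)
    (p : R * R * R) : Prop :=
  equilibrium g f1 f2 p /\ no_imaginary_eigenvalue (linearization g f1 f2 p).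

Definition saddle (R : realType) (g f1 f2 : R * R * R -> R)
    (p : R * R * R) : Prop :=
  equilibrium g f1 f2 p /\
  exists l1 l2, real_eigenvalues (linearization g f1 f2 p) l1 l2 /\ l1 * l2 < 0.

Definition node (R : realType) (g f1 f2 : R * R * R -> R)
    (p : R * R * R) : Prop :=
  equilibrium g f1 f2 p /\
  exists l1 l2, real_eigenvalues (linearization g f1 f2 p) l1 l2 /\ 0 < l1 * l2.

Definition singular_equilibrium (R : realType) (g f1 : R * R * R -> R)
    (p : R * R * R) : Prop :=
  g p = 0 /\ f1 p = 0.

Definition simple_singular_equilibrium (R : realType)
    (g f1 f2 : R * R * R -> R) (p : R * R * R) : Prop :=
  singular_equilibrium g f1 p /\
  [/\ f2 p != 0, 'D_(dirx R) g p != 0,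
      \det (jacmx [tuple f1; g] [tuple dirx R; diry R] p) != 0 &
      no_imaginary_eigenvalue (linearization g f1 f2 p)].

Definition folded_saddle (R : realType) (g f1 f2 : R * R * R -> R)
    (p : R * R * R) : Prop :=
  simple_singular_equilibrium g f1 f2 p /\
  exists l1 l2, real_eigenvalues (linearization g f1 f2 p) l1 l2 /\ l1 * l2 < 0.

Definition folded_node (R : realType) (g f1 f2 : R * R * R -> R)
    (p : R * R * R) : Prop :=
  simple_singular_equilibrium g f1 f2 p /\
  exists l1 l2, real_eigenvalues (linearization g f1 f2 p) l1 l2 /\ 0 < l1 * l2.

Definition mx22 (R : realType) (a b c d : R) : 'M[R]_2 :=
  \matrix_(i < 2, j < 2)
    tnth (tnth [tuple [tuple a; b]; [tuple c; d]] i) j.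

Lemma linearization_EQ (R : realType) (g f1 f2 : R * R * R -> R)
    (p : R * R * R) :
  differentiable f2 p -> differentiable g p -> equilibrium g f1 f2 p ->
  linearization g f1 f2 p =
    mx22 ('D_(dirx R) f1 p)       ('D_(diry R) f1 p)
         (g p * 'D_(dirx R) f2 p) (g p * 'D_(diry R) f2 p).
Proof.
move=> df2 dg [_ f20 _].
have DM v : 'D_v (fun q => f2 q * g q) p = g p * 'D_v f2 p.
  rewrite [LHS]deriveM; [|exact: diff_derivable..].
  by rewrite f20 scale0r add0r.
apply/matrixP => i j; rewrite !mxE /desingularized.
case: i => [[|[|//]] Hi]; case: j => [[|[|//]] Hj]; rewrite !(tnth_nth 0) //=.
all: by rewrite ?(tnth_nth (fun=> 0)) /= ?DM.
Qed.

Lemma linearization_sEQ (R : realType) (g f1 f2 : R * R * R -> R)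
    (p : R * R * R) :
  differentiable f2 p -> differentiable g p -> singular_equilibrium g f1 p ->
  linearization g f1 f2 p =
    mx22 ('D_(dirx R) f1 p)       ('D_(diry R) f1 p)
         ('D_(dirx R) g p * f2 p) ('D_(diry R) g p * f2 p).
Proof.
move=> df2 dg [g0 _].
have DM v : 'D_v (fun q => f2 q * g q) p = 'D_v g p * f2 p.
  rewrite [LHS]deriveM; [|exact: diff_derivable..].
  by rewrite g0 scale0r addr0 mulrC.
apply/matrixP => i j; rewrite !mxE /desingularized.
case: i => [[|[|//]] Hi]; case: j => [[|[|//]] Hj]; rewrite !(tnth_nth 0) //=.
all: by rewrite ?(tnth_nth (fun=> 0)) /= ?DM.
Qed.

(* Main.v *)
(* The reduced equations are f1 = f2 = 0 for the equilibrium and f1 = g = 0 for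
   the singular equilibrium.  Since f1, f2, g are C^1, they are strictly
   differentiable at the origin, so each pair has a unique zero E(alpha), resp.
   S(alpha), near the origin, of size O(alpha), by a contraction argument.
   Let J2 = det d(f1,f2)/d(x,y), Jg = det d(f1,g)/d(x,y) and
   D = det d(f1,f2,g)/d(x,y,alpha).  By Cramer's rule J2 g(E) = D alpha + o(alpha)
   and Jg f2(S) = -D alpha + o(alpha), as swapping two rows changes the sign of D.
   The linearizations have determinants g(E) J2(E) and f2(S) Jg(S), so these are
   nonzero, small and of opposite signs, while both traces are close to
   f1x <> 0: all eigenvalues are real and nonzero, and exactly one of the two
   points is of saddle type. *)
Require Import Defs.
From HB Require Import structures.
From mathcomp Require Import all_boot all_order all_algebra.
From mathcomp Require Import all_classical all_reals all_analysis.
From mathcomp Require Import complex ring lra.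

Set Implicit Arguments.
Unset Strict Implicit.
Unset Printing Implicit Defensive.

Import Order.TTheory GRing.Theory Num.Theory.
Import numFieldNormedType.Exports.

Local Open Scope classical_set_scope.
Local Open Scope ring_scope.

(** * Mean value estimates and strict differentiability at the origin *)

Lemma derive_along_line (R : realType) (V : normedModType R) (f : V -> R)
    (q v : V) (t : R) :
  derivable f (q + t *: v) v ->
  is_derive t 1 (fun s : R => f (q + s *: v)) ('D_v f (q + t *: v)).
Proof.
move=> df; have E : (fun h : R => h^-1 *:
      ((fun s : R => f (q + s *: v)) (h *: 1 + t) - f (q + t *: v))) =
    (fun h : R => h^-1 *: (f (h *: v + (q + t *: v)) - f (q + t *: v))).
  apply/funext => h; congr (_ *: (f _ - _)).
  by rewrite [h *: 1]mulr1 scalerDl addrCA addrA.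
by split; rewrite /derivable /derive E.
Qed.

(** Restricting [f] to the line through [q] and [p] reduces this to the mean value theorem on the
    unit interval. *)
Lemma derive_mean_value (R : realType) (V : normedModType R) (f : V -> R)
    (p q : V) :
  (forall z, differentiable f z) ->
  exists2 t : R, 0 <= t <= 1 & f p - f q = 'D_(p - q) f (q + t *: (p - q)).
Proof.
move=> df; have dphi t := @derive_along_line R V f q (p - q) t
  (diff_derivable (df _)).
have [| t t01] := @MVT_segment R _ _ 0 1 ler01 (fun t _ => dphi t).
- apply: continuous_subspaceT => t; apply: differentiable_continuous.
  by apply/derivable1_diffP; have [] := dphi t.
- rewrite scale1r scale0r addr0 subrKC subr0 mulr1 => E.
  by exists t => //; rewrite in_itv in t01.
Qed.

Lemma derive_coords (R : realType) (f : R * R * R -> R) (p v : R * R * R) :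
  differentiable f p ->
  'D_v f p = v.1.1 * 'D_(dirx R) f p + v.1.2 * 'D_(diry R) f p
             + v.2 * 'D_(dira R) f p.
Proof.
move=> df; rewrite !deriveE //.
have {1}-> : v = v.1.1 *: dirx R + v.1.2 *: diry R + v.2 *: dira R.
  case: v => [[x y] a] /=.
  rewrite /dirx /diry /dira; congr (_, _, _) => /=;
    by rewrite /GRing.scale /= ?(mulr0, mulr1, addr0, add0r).
by rewrite !linearD !linearZ.
Qed.

(** Strict differentiability at the origin with gradient [(a, b, c)]. Both points move, which is
    what makes the maps in [solve2_normal] contractions; differentiability at a single point would
    not suffice for that. *)
Definition strict_diff0 (R : realType) (f : R * R * R -> R) (a b c : R) :=
  forall e : R, 0 < e -> exists2 d : R, 0 < d &
  forall p q : R * R * R, `|p| <= d -> `|q| <= d ->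
  `|f p - f q - (a * (p.1.1 - q.1.1) + b * (p.1.2 - q.1.2) + c * (p.2 - q.2))|
    <= e * `|p - q|.

Lemma norm_coords (R : realType) (v : R * R * R) (r : R) :
  (`|v| <= r) = [&& `|v.1.1| <= r, `|v.1.2| <= r & `|v.2| <= r].
Proof. by rewrite !prod_normE !ge_max -andbA. Qed.

(** The mean value theorem replaces [f p - f q] by a derivative at a point of the segment. Near the
    origin each of the three partial derivatives is within [e / 3] of its value at the origin, and
    the three errors add up to [e]. *)
Lemma smooth_strict_diff0 (R : realType) (f : R * R * R -> R) :
  Ck 1 f ->
  strict_diff0 f ('D_(dirx R) f 0) ('D_(diry R) f 0) ('D_(dira R) f 0).
Proof.
move=> [df cf] e e0.
have e30 : 0 < e / 3 by rewrite divr_gt0.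
have near_part v : \forall p \near (0 : R * R * R), `|'D_v f 0 - 'D_v f p| <= e / 3.
  by have /cvgrPdist_le/(_ _ e30) := cf v 0.
have [d /= dP] := (nbhs_closedballP _ _).1 (
  filterI (near_part (dirx R)) (filterI (near_part (diry R)) (near_part (dira R)))).
exists d%:num => // p q pd qd.
have [t /andP[t0 t1] ->] := derive_mean_value p q df.
set z := q + _.
(* The intermediate point is a convex combination of [p] and [q], hence stays in the ball. *)
have zd : `|z| <= d%:num.
  have -> : z = (1 - t) *: q + t *: p.
    by rewrite /z scalerBr scalerBl scale1r addrAC addrA.
  rewrite (le_trans (ler_normD _ _))// !normrZ !ger0_norm ?subr_ge0//.
  apply: (@le_trans _ _ ((1 - t) * d%:num + t * d%:num)); last first.
    by rewrite -mulrDl subrK mul1r.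
  by rewrite lerD// ler_wpM2l// subr_ge0.
have [|hx [hy ha]] := dP z.
  by rewrite closed_ballE //= /closed_ball_ /= sub0r normrN.
rewrite (derive_coords _ (df z)).
have /and3P[vx vy va] : [&& `|(p - q).1.1| <= `|p - q|, `|(p - q).1.2| <= `|p - q|
  & `|(p - q).2| <= `|p - q|] by rewrite -norm_coords.
rewrite -[p.1.1 - _]/((p - q).1.1) -[p.1.2 - _]/((p - q).1.2) -[p.2 - _]/((p - q).2).
move: (p - q) vx vy va {pd qd} => v.
move: ('D_(dirx R) f 0) ('D_(diry R) f 0) ('D_(dira R) f 0) hx hy ha => a b c.
move: ('D_(dirx R) f z) ('D_(diry R) f z) ('D_(dira R) f z) => a' b' c'.
move: v.1.1 v.1.2 v.2 `|v| => x y s r hx hy ha vx vy va.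
rewrite (_ : _ - _ = - (x * (a - a') + y * (b - b') + s * (c - c'))); last by ring.
rewrite normrN (_ : e * r = r * (e / 3) + r * (e / 3) + r * (e / 3)); last by field.
by rewrite !(le_trans (ler_normD _ _), lerD)// normrM ler_pM.
Qed.

(** * Real eigenvalues of matrices of size 2 *)

(** The quadratic formula gives two reals with sum [\tr A] and product [\det A]; the two monic
    polynomials of degree 2 then agree coefficientwise. *)
Lemma real_eigenvalues_exist (R : realType) (A : 'M[R]_2) :
  0 <= (\tr A) ^+ 2 - 4 * \det A ->
  exists l1 l2 : R, real_eigenvalues A l1 l2 /\ l1 * l2 = \det A.
Proof.
move=> D0; pose s := Num.sqrt ((\tr A) ^+ 2 - 4 * \det A).
have s2 : s ^+ 2 = (\tr A) ^+ 2 - 4 * \det A by rewrite sqr_sqrtr.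
have sumE : (\tr A + s) / 2 + (\tr A - s) / 2 = \tr A by field.
have prodE : (\tr A + s) / 2 * ((\tr A - s) / 2) = \det A.
  rewrite (_ : _ * _ = ((\tr A) ^+ 2 - s ^+ 2) / 4); last by field.
  by rewrite s2; field.
exists ((\tr A + s) / 2), ((\tr A - s) / 2); split => //.
have lead : (char_poly A)`_2 = 1.
  by move/monicP: (char_poly_monic A); rewrite /lead_coef size_char_poly.
rewrite /real_eigenvalues.
move: ((_ + s) / 2) ((_ - s) / 2) sumE prodE => a b sumE prodE.
have -> : ('X - a%:P) * ('X - b%:P) = 'X^2 - (\tr A) *: 'X + (\det A)%:P.
  by rewrite -sumE -prodE -mul_polyC polyCD polyCM; ring.
apply/polyP => -[|[|[|i]]].
- by rewrite char_poly_det !coefE /=; ring.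
- by rewrite (@char_poly_trace _ 2 A) // !coefE /=; ring.
- by rewrite lead !coefE /=; ring.
- by rewrite nth_default ?size_char_poly// !coefE /=; ring.
Qed.

(** The factorization persists over the complex numbers, so every complex eigenvalue is one of the
    nonzero reals [l1], [l2]. *)
Lemma no_imaginary_eigenvalue_real (R : realType) (A : 'M[R]_2) (l1 l2 : R) :
  real_eigenvalues A l1 l2 -> l1 * l2 != 0 -> no_imaginary_eigenvalue A.
Proof.
move=> eA; rewrite mulf_eq0 negb_or => /andP[l10 l20] l.
rewrite eigenvalue_root_char -map_char_poly eA rmorphM !rmorphB /=
  !map_polyX !map_polyC /=.
by rewrite rootM !root_XsubC => /orP[] /eqP ->.
Qed.

(** * Solving two equations in the plane by contraction *)

Lemma compact_contraction_fixpoint (R : realType) (V : normedModType R)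
    (K : set V) (T : V -> V) (q : R) :
  compact K -> K !=set0 -> continuous T -> (forall z, K z -> K (T z)) ->
  q < 1 -> (forall z w, K z -> K w -> `|T z - T w| <= q * `|z - w|) ->
  exists2 z, K z & T z = z.
Proof.
move=> cK K0 cT KT q1 Tq.
(* A minimizer of the displacement [|z - T z|] is fixed, T z having a smaller one. *)
have [|z zK zmin] := @compact_EVT_min V R (fun z => `|z - T z|) K K0 cK.
  apply: continuous_subspaceT => z.
  apply: (@continuous_comp _ _ _ (fun z => z - T z) (fun z => `|z|));
    last exact: norm_continuous.
  by apply: continuousB; [exact: id|exact: cT].
rewrite inE in zK; exists z => //; apply/eqP; rewrite eq_sym -subr_eq0 -normr_le0.
have := zmin (T z); rewrite inE => /(_ (KT _ zK)) h.
have := le_trans h (Tq _ _ zK (KT _ zK)).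
rewrite -subr_le0 -{1}[`|z - T z|]mul1r -mulrBl pmulr_rle0 //; lra.
Qed.

(** The product norm is the maximum norm, so this ball is a square. *)
Lemma compact_ball_prod (R : realType) (r : R) :
  compact [set z : R * R | `|z| <= r].
Proof.
rewrite (_ : [set _ | _] = `[-r, r]%classic `*` `[-r, r]%classic).
  by apply: compact_setX; exact: segment_compact.
by apply/seteqP; split => -[x y]; rewrite /= prod_normE ge_max /=
   !in_itv /= !ler_norml => /andP.
Qed.

Lemma continuous_pair (T U V : topologicalType) (f : T -> U) (g : T -> V) (z : T) :
  {for z, continuous f} -> {for z, continuous g} ->
  {for z, continuous (fun x => (f x, g x))}.
Proof. by move=> fz gz; exact: (cvg_pair fz gz). Qed.

Lemma strict_diff0_lin (R : realType) (f g : R * R * R -> R)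
    (a b c a' b' c' s t : R) :
  strict_diff0 f a b c -> strict_diff0 g a' b' c' ->
  strict_diff0 (fun p => s * f p + t * g p)
    (s * a + t * a') (s * b + t * b') (s * c + t * c').
Proof.
(* The summand 1 keeps [M] positive even when [s] and [t] both vanish. *)
move=> hf hg e e0; pose M := `|s| + `|t| + 1.
have M0 : 0 < M by rewrite /M ltr_wpDl// addr_ge0.
have [d d0 df] := hf _ (divr_gt0 e0 M0); have [d' d0' dg] := hg _ (divr_gt0 e0 M0).
exists (Num.min d d'); first by rewrite lt_min d0.
move=> p q; rewrite !le_min => /andP[pd pd'] /andP[qd qd'].
have {df} := df p q pd qd; have {dg} := dg p q pd' qd'.
have := normr_ge0 (p - q).
move: (f p) (f q) (g p) (g q) (p.1.1 - q.1.1) (p.1.2 - q.1.2) (p.2 - q.2) `|p - q|.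
move=> u v u' v' x y z r r0 hg' hf'.
rewrite (_ : _ - _ = s * (u - v - (a * x + b * y + c * z))
  + t * (u' - v' - (a' * x + b' * y + c' * z))); last by ring.
have -> : e * r = M * (e / M * r) by field; rewrite gt_eqF.
rewrite (le_trans (ler_normD _ _))// !normrM /M mulrDl mul1r mulrDl.
by rewrite (le_trans (lerD (ler_wpM2l _ hf') (ler_wpM2l _ hg')))//
  lerDl mulr_ge0// divr_ge0 // ltW.
Qed.

(** The case where the Jacobian matrix in the plane variables is the identity. Common zeros of [u]
    and [v] are the fixed points of [z - (u, v)], a contraction with factor 1/2. Existence is
    obtained in the small ball of radius K |alpha|, uniqueness in the fixed ball of radius [r]. *)
Lemma solve2_normal (R : realType) (u v : R * R * R -> R) (k m : R) :
  strict_diff0 u 1 0 k -> strict_diff0 v 0 1 m ->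
  continuous u -> continuous v -> u 0 = 0 -> v 0 = 0 ->
  exists r K : R, [/\ 0 < r, 0 < K & forall alpha, K * `|alpha| <= r ->
    exists z, [/\ `|z| <= K * `|alpha|, u (z, alpha) = 0, v (z, alpha) = 0 &
      forall w, `|w| <= r -> u (w, alpha) = 0 -> v (w, alpha) = 0 -> w = z]].
Proof.
move=> su sv cu cv u0 v0.
have h0 : (0 : R) < 1 / 2 by rewrite divr_gt0.
have [d d0 du] := su _ h0; have [d' d0' dv] := sv _ h0.
(* [K] is twice the factor bounding |T 0| by a multiple of |alpha|. Since it is at least 2, the
   assumption K |alpha| <= r also gives |alpha| <= r. *)
pose r := Num.min d d'; pose K := 2 * (`|k| + `|m| + 1).
have K2 : 2 <= K by rewrite /K ler_pMr// lerDr addr_ge0.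
exists r, K; split; [by rewrite lt_min d0|exact: lt_le_trans K2|].
move=> alpha alphar.
have alphad : `|alpha| <= r.
  by apply: le_trans alphar; rewrite ler_peMl// (le_trans _ K2)// ler1n.
pose T z : R * R := (z.1 - u (z, alpha), z.2 - v (z, alpha)).
have ball_rd (z : R * R) (a : R) : `|z| <= r -> `|a| <= r ->
    `|(z, a)| <= d /\ `|(z, a)| <= d'.
  by rewrite !le_min prod_normE !ge_max /= => /andP[-> ->] /andP[-> ->].
(* Both points carry the same [alpha] and the linear part of [(u, v)] in the plane is the identity,
   so only the error term of strict differentiability survives. *)
have T_contr z w : `|z| <= r -> `|w| <= r -> `|T z - T w| <= 1 / 2 * `|z - w|.
  move=> zr wr.
  have [zd zd'] := ball_rd z alpha zr alphad.
  have [wd wd'] := ball_rd w alpha wr alphad.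
  have zwE : `|(z, alpha) - (w, alpha)| = `|z - w|.
    by rewrite prod_normE /= subrr normr0; apply/max_idPl.
  have := du _ _ zd wd; have := dv _ _ zd' wd'; rewrite zwE /= => hv hu.
  rewrite prod_normE ge_max /=; apply/andP; split.
    rewrite -normrN (le_trans _ hu)//.
    by rewrite le_eqVlt; apply/predU1P; left; congr `|_|; ring.
  rewrite -normrN (le_trans _ hv)//.
    by rewrite le_eqVlt; apply/predU1P; left; congr `|_|; ring.
have n0 : `|(0 : R * R)| <= r by rewrite normr0 le_min !ltW.
have T0 : `|T 0| <= K / 2 * `|alpha|.
  have z0 : `|(0 : R)| <= r by rewrite normr0 le_min !ltW.
  have [ad ad'] := ball_rd 0 alpha n0 alphad; have [zd zd'] := ball_rd 0 0 n0 z0.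
  have aE : `|((0 : R * R), alpha) - (0, 0)| = `|alpha|.
    by rewrite prod_normE /= !subr0 normr0; apply/max_idPr.
  have := du _ _ ad zd; have := dv _ _ ad' zd'.
  rewrite aE u0 v0 /= !subrr !mulr0 !subr0 !add0r => hv hu.
  have -> : K / 2 * `|alpha| = `|k * alpha| + `|m * alpha| + `|alpha|.
    by rewrite !normrM /K; field.
  rewrite prod_normE ge_max /= !sub0r !normrN; apply/andP; split.
    rewrite -[u _](subrK (k * alpha)) (le_trans (ler_normD _ _))//.
    by have := normr_ge0 (m * alpha); have := normr_ge0 alpha; lra.
  rewrite -[v _](subrK (m * alpha)) (le_trans (ler_normD _ _))//.
  by have := normr_ge0 (k * alpha); have := normr_ge0 alpha; lra.
have cT : continuous T.
  move=> z; have cpair (f : R * R * R -> R) : continuous f ->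
      {for z, continuous (fun z => f (z, alpha))}.
    move=> cf; apply: (@continuous_comp _ _ _ (fun z => (z, alpha)) f); last exact: cf.
    by apply: continuous_pair; [exact: cvg_id|exact: cvg_cst].
  by apply: (@continuous_pair _ _ _ (fun z => z.1 - u (z, alpha))
      (fun z => z.2 - v (z, alpha))); apply: continuousB;
    [exact: cvg_fst|exact: cpair|exact: cvg_snd|exact: cpair].
have [|||||z zK Tz] := @compact_contraction_fixpoint R _
    [set z : R * R | `|z| <= K * `|alpha|] T (1 / 2) (@compact_ball_prod R _).
- by exists 0; rewrite /= normr0 mulr_ge0// (le_trans _ K2).
- by [].
(* The ball is mapped into itself: |T z - T 0| and |T 0| are each at most half of K |alpha|. *)
- move=> z zK; have := T_contr z 0 (le_trans zK alphar) n0; rewrite subr0 => Tz0.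
  rewrite -[T z](subrK (T 0)) /= (le_trans (ler_normD _ _))//.
  by move: zK => /= zK; lra.
- lra.
- by move=> z w zK wK; apply: T_contr; rewrite (le_trans _ alphar).
exists z; split => //.
- by have := congr1 fst Tz => /= /eqP; rewrite subr_eq addrC -subr_eq subrr => /eqP.
- by have := congr1 snd Tz => /= /eqP; rewrite subr_eq addrC -subr_eq subrr => /eqP.
move=> w wr uw vw; apply/eqP; rewrite -subr_eq0 -normr_le0.
have := T_contr w z wr (le_trans zK alphar).
by rewrite Tz /T uw vw !subr0 -surjective_pairing; lra.
Qed.

(** Multiplying [(u, v)] by the inverse of its Jacobian matrix in the plane variables keeps the
    common zeros and reduces to [solve2_normal]. *)
Lemma solve2 (R : realType) (u v : R * R * R -> R) (a b c a' b' c' : R) :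
  strict_diff0 u a b c -> strict_diff0 v a' b' c' -> a * b' - a' * b != 0 ->
  continuous u -> continuous v -> u 0 = 0 -> v 0 = 0 ->
  exists (r K : R) (Z : R -> R * R), [/\ 0 < r, 0 < K &
    forall alpha, K * `|alpha| <= r ->
      [/\ `|Z alpha| <= K * `|alpha|, u (Z alpha, alpha) = 0,
          v (Z alpha, alpha) = 0 &
          forall w, `|w| <= r -> u (w, alpha) = 0 -> v (w, alpha) = 0 ->
            w = Z alpha]].
Proof.
move=> su sv; set J := _ - _ => J0 cu cv u0 v0.
have := strict_diff0_lin (b' / J) (- b / J) su sv.
have := strict_diff0_lin (- a' / J) (a / J) su sv.
have -> : - a' / J * a + a / J * a' = 0 by field.
have -> : - a' / J * b + a / J * b' = 1 by rewrite /J; field.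
have -> : b' / J * a + - b / J * a' = 1 by rewrite /J; field.
have -> : b' / J * b + - b / J * b' = 0 by field.
have clin s t : continuous (fun p => s * u p + t * v p).
  by move=> p; apply: cvgD; apply: cvgM; [exact: cvg_cst|exact: cu|exact: cvg_cst|exact: cv].
move=> sv' su'; have [||r [K [r0 K0 H]]] := solve2_normal su' sv' (clin _ _) (clin _ _).
- by rewrite u0 v0 !mulr0 addr0.
- by rewrite u0 v0 !mulr0 addr0.
(* Choice needs a value for every [alpha]; the default 0 is taken where nothing is claimed. *)
have /choice[Z HZ] : forall alpha, exists z, K * `|alpha| <= r ->
    [/\ `|z| <= K * `|alpha|, u (z, alpha) = 0, v (z, alpha) = 0 &
      forall w, `|w| <= r -> u (w, alpha) = 0 -> v (w, alpha) = 0 -> w = z].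
  move=> alpha; have [/H|_] := boolP (K * `|alpha| <= r); last by exists 0.
  move=> [z [zK uz vz zuniq]]; exists z => _; split => //.
  (* Multiplying back by the Jacobian matrix recovers [u] and [v] from the two combinations. *)
  - transitivity (a * 0 + b * 0); last by ring.
    by rewrite -{1}uz -vz /J; field.
  - transitivity (a' * 0 + b' * 0); last by ring.
    by rewrite -{1}uz -vz /J; field.
  - by move=> w wr uw vw; apply: zuniq => //; rewrite uw vw !mulr0 addr0.
by exists r, K, Z.
Qed.

(** * Sign of a third function at a common zero of two others *)

Lemma cramer_sign (R : realType) (u v w : R * R * R -> R)
    (a b c a' b' c' a'' b'' c'' K D : R) :
  strict_diff0 u a b c -> strict_diff0 v a' b' c' -> strict_diff0 w a'' b'' c'' ->
  u 0 = 0 -> v 0 = 0 -> w 0 = 0 -> 0 < K ->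
  D = a * (b' * c'' - c' * b'') - b * (a' * c'' - c' * a'')
      + c * (a' * b'' - b' * a'') -> D != 0 ->
  exists2 d, 0 < d & forall z alpha, 0 < `|alpha| ->
    `|alpha| <= d -> `|z| <= K * `|alpha| ->
    u (z, alpha) = 0 -> v (z, alpha) = 0 ->
    0 < (a * b' - a' * b) * w (z, alpha) * (D * alpha).
Proof.
set J := a * b' - a' * b.
move=> su sv sw u0 v0 w0 K0 DE D0.
(* The partial derivatives in x and y of [J w + s u + t v] vanish at 0, and the
   one in alpha is D. *)
pose s := - (a'' * b' - b'' * a'); pose t := - (b'' * a - a'' * b).
have := strict_diff0_lin J 1 sw (strict_diff0_lin s t su sv).
have -> : J * a'' + 1 * (s * a + t * a') = 0 by rewrite /J /s /t; ring.
have -> : J * b'' + 1 * (s * b + t * b') = 0 by rewrite /J /s /t; ring.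
have -> : J * c'' + 1 * (s * c + t * c') = D by rewrite DE /J /s /t; ring.
have K10 : 0 < K + 1 by rewrite addr_gt0.
(* The point [(z, alpha)] has norm at most (K + 1) |alpha|, so with this [e] the error is at most
   half of |D alpha|, and [J * w] takes the sign of [D * alpha]. *)
have e0 : 0 < `|D| / (2 * (K + 1)) by rewrite divr_gt0 ?normr_gt0// mulr_gt0.
move=> /(_ _ e0)[d d0 sW].
exists (d / (K + 1)); first by rewrite divr_gt0.
move=> z alpha alpha0 alphad zK uz vz.
have pK : `|(z, alpha)| <= (K + 1) * `|alpha|.
  rewrite prod_normE ge_max /= mulrDl mul1r; apply/andP; split.
    by apply: (le_trans zK); rewrite lerDl.
  by rewrite lerDr mulr_ge0// ltW.
have pd : `|(z, alpha)| <= d by rewrite (le_trans pK)// mulrC -ler_pdivlMr.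
have := sW (z, alpha) 0 pd; rewrite normr0 ltW// => /(_ isT).
rewrite uz vz u0 v0 w0 /= !(mul0r, subr0, mulr0, add0r, addr0) => h.
have {h} h : `|J * w (z, alpha) - D * alpha| <= `|D * alpha| / 2.
  rewrite (le_trans h)// (le_trans (ler_wpM2l (ltW e0) pK))// normrM.
  rewrite le_eqVlt; apply/orP; left; apply/eqP; field; exact: lt0r_neq0.
have : 0 < `|D * alpha| by rewrite normr_gt0 mulf_neq0// -normr_gt0.
move: h; move: (J * w (z, alpha)) (D * alpha) => x y.
have [y0 h _|y0 h _|->] := ltgtP y 0; last by rewrite normr0 ltxx.
  by rewrite nmulr_lgt0//; move: h; rewrite (ltr0_norm y0) ler_norml; lra.
by rewrite pmulr_lgt0//; move: h; rewrite (gtr0_norm y0) ler_norml; lra.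
Qed.

(** * Explicit determinants and traces *)

Lemma det2 (R : comRingType) (A : 'M[R]_2) :
  \det A = A 0 0 * A 1 1 - A 0 1 * A 1 0.
Proof.
have l0 : lift 0 0 = 1 :> 'I_2 by exact: val_inj.
have l1 : lift 1 0 = 0 :> 'I_2 by exact: val_inj.
rewrite (expand_det_row _ 0) big_ord_recl big_ord1 /cofactor !det_mx11 !mxE l0 l1.
by rewrite addn0 expr0 mul1r add0n expr1 mulN1r mulrN.
Qed.

Lemma det3 (R : comRingType) (A : 'M[R]_3) :
  \det A = A 0 0 * (A 1 1 * A 2 2 - A 1 2 * A 2 1)
         - A 0 1 * (A 1 0 * A 2 2 - A 1 2 * A 2 0)
         + A 0 2 * (A 1 0 * A 2 1 - A 1 1 * A 2 0).
Proof.
have l00 : lift 0 0 = 1 :> 'I_3 by exact: val_inj.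
have l01 : lift 0 1 = 2 :> 'I_3 by exact: val_inj.
have l10 : lift 1 0 = 0 :> 'I_3 by exact: val_inj.
have l11 : lift 1 1 = 2 :> 'I_3 by exact: val_inj.
have l20 : lift 2 0 = 0 :> 'I_3 by exact: val_inj.
have l21 : lift 2 1 = 1 :> 'I_3 by exact: val_inj.
have k0 : lift 0 0 = 1 :> 'I_2 by exact: val_inj.
rewrite (expand_det_row _ 0) big_ord_recl big_ord_recl big_ord1 /cofactor !det2 !mxE.
rewrite k0 l00 l01 l10 l11 l20 l21.
by rewrite /= /bump /= !addn0 !add0n /= expr0 expr1 sqrrN expr1n
  !mul1r mulN1r mulrN addrA.
Qed.

Lemma det_jacmx2 (R : realType) (f h : R * R * R -> R) (v w p : R * R * R) :
  \det (jacmx [tuple f; h] [tuple v; w] p) =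
  'D_v f p * 'D_w h p - 'D_w f p * 'D_v h p.
Proof. by rewrite det2 !mxE. Qed.

Lemma det_jacmx3 (R : realType) (f h k : R * R * R -> R) (u v w p : R * R * R) :
  \det (jacmx [tuple f; h; k] [tuple u; v; w] p) =
  'D_u f p * ('D_v h p * 'D_w k p - 'D_w h p * 'D_v k p)
  - 'D_v f p * ('D_u h p * 'D_w k p - 'D_w h p * 'D_u k p)
  + 'D_w f p * ('D_u h p * 'D_v k p - 'D_v h p * 'D_u k p).
Proof. by rewrite det3 !mxE. Qed.

Lemma det_jacmx3_swap (R : realType) (f h k : R * R * R -> R) (u v w p : R * R * R) :
  \det (jacmx [tuple f; k; h] [tuple u; v; w] p) =
  - \det (jacmx [tuple f; h; k] [tuple u; v; w] p).
Proof.
rewrite !det_jacmx3.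
move: ('D_u f p) ('D_v f p) ('D_w f p) ('D_u h p) ('D_v h p) ('D_w h p).
by move: ('D_u k p) ('D_v k p) ('D_w k p) => *; ring.
Qed.

Lemma tr_mx22 (R : realType) (a b c d : R) : \tr (mx22 a b c d) = a + d.
Proof. by rewrite /mxtrace big_ord_recl big_ord1 !mxE. Qed.

Lemma det_mx22 (R : realType) (a b c d : R) : \det (mx22 a b c d) = a * d - b * c.
Proof. by rewrite det2 !mxE. Qed.

(** * Types of the two points in terms of trace and determinant *)

(** A nonnegative discriminant makes the eigenvalues real. Their product is the determinant, whose
    sign then decides the type. *)
Lemma equilibrium_type (R : realType) (g f1 f2 : R * R * R -> R)
    (p : R * R * R) :
  let A := linearization g f1 f2 p in
  equilibrium g f1 f2 p -> 0 <= (\tr A) ^+ 2 - 4 * \det A -> \det A != 0 ->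
  [/\ simple_equilibrium g f1 f2 p, \det A < 0 -> saddle g f1 f2 p &
      0 < \det A -> node g f1 f2 p].
Proof.
move=> A eq_p /real_eigenvalues_exist[l1 [l2 [eA dA]]] A0.
split; [split => //| |]; rewrite -?dA.
- by apply: no_imaginary_eigenvalue_real eA _; rewrite dA.
- by move=> ?; split => //; exists l1, l2.
- by move=> ?; split => //; exists l1, l2.
Qed.

Lemma singular_equilibrium_type (R : realType) (g f1 f2 : R * R * R -> R)
    (p : R * R * R) :
  let A := linearization g f1 f2 p in
  singular_equilibrium g f1 p -> f2 p != 0 -> 'D_(dirx R) g p != 0 ->
  \det (jacmx [tuple f1; g] [tuple dirx R; diry R] p) != 0 ->
  0 <= (\tr A) ^+ 2 - 4 * \det A -> \det A != 0 ->
  [/\ simple_singular_equilibrium g f1 f2 p,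
      \det A < 0 -> folded_saddle g f1 f2 p &
      0 < \det A -> folded_node g f1 f2 p].
Proof.
move=> A eq_p f2p gxp J0 /real_eigenvalues_exist[l1 [l2 [eA dA]]] A0.
have simple_p : simple_singular_equilibrium g f1 f2 p.
  by split => //; split => //; apply: no_imaginary_eigenvalue_real eA _; rewrite dA.
by split => //; rewrite -?dA => ?; split => //; exists l1, l2.
Qed.

(** * Limits, neighbourhoods of the origin and transfer of signs *)

Lemma cvg_linear_bound (R : realType) (E : R -> R * R) (K alpha0 : R) :
  0 < K -> 0 < alpha0 ->
  (forall alpha, 0 < `|alpha| < alpha0 -> `|E alpha| <= K * `|alpha|) ->
  E alpha @[alpha --> 0^'] --> ((0, 0) : R * R).
Proof.
move=> K0 a0 EK; apply/cvgrPdist_le => e e0; near=> alpha.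
rewrite -[(0, 0)]/(0 : R * R) sub0r normrN (le_trans (EK _ _))//.
  rewrite normr_gt0; apply/andP; split; first by near: alpha; exact: nbhs_dnbhs_neq.
  by near: alpha; exact: dnbhs0_lt.
rewrite mulrC -ler_pdivlMr//; near: alpha.
by apply: dnbhs0_le; rewrite divr_gt0.
Unshelve. all: by end_near. Qed.

Lemma near_closed_ball (R : realType) (V : normedModType R) (P : set V) :
  (\forall p \near (0 : V), P p) ->
  exists2 d : R, 0 < d & forall p, `|p| <= d -> P p.
Proof.
move=> /nbhs_closedballP[d dP]; exists d%:num => // p pd; apply: dP.
by rewrite closed_ballE //= /closed_ball_ /= sub0r normrN.
Qed.

Lemma continuous_near_gt0 (R : realType) (V : normedModType R) (h : V -> R) :
  continuous h -> 0 < h 0 -> \forall p \near (0 : V), 0 < h p.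
Proof. by move=> ch h0; exact: (cvgr_gt _ (ch 0) _ h0). Qed.

(** Used with [y] a Jacobian determinant at the origin and [x] its value at a nearby point: having
    the same sign, they can be exchanged. Indeed y^2 times the claimed quantity is the product of
    the two hypotheses. *)
Lemma mulr_gt0_cancel (R : realDomainType) (x y z t : R) :
  0 < x * y -> 0 < y * z * t -> 0 < z * x * t.
Proof.
move=> xy yzt; have y0 : y != 0 by apply: contraTneq xy => ->; rewrite mulr0 ltxx.
have : 0 < y ^+ 2 * (z * x * t).
  by rewrite (_ : _ * _ = x * y * (y * z * t)); [exact: mulr_gt0|ring].
by rewrite pmulr_rgt0// exprn_even_gt0.
Qed.

Theorem lemma4p1 (R : realType) (g f1 f2 : R * R * R -> R)
    (smooth_g : smooth g) (smooth_f1 : smooth f1) (smooth_f2 : smooth f2)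
    (g0 : g (0, 0, 0) = 0) (f10 : f1 (0, 0, 0) = 0) (f20 : f2 (0, 0, 0) = 0)
    (f1x : 'D_(dirx R) f1 (0, 0, 0) != 0)
    (gx : 'D_(dirx R) g (0, 0, 0) != 0)
    (det_f1f2 :
      \det (jacmx [tuple f1; f2] [tuple dirx R; diry R] (0, 0, 0)) != 0)
    (det_f1g :
      \det (jacmx [tuple f1; g] [tuple dirx R; diry R] (0, 0, 0)) != 0)
    (det_f1f2g :
      \det (jacmx [tuple f1; f2; g] [tuple dirx R; diry R; dira R] (0, 0, 0))
        != 0) :
  exists (U : set (R * R)) (alpha0 : R) (E S : R -> R * R),
    [/\ nbhs ((0, 0) : R * R) U,
        0 < alpha0,
        forall alpha : R, 0 < `|alpha| < alpha0 ->
          [/\ U (E alpha) /\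
                (forall z, U z ->
                   (equilibrium g f1 f2 (z, alpha) <-> z = E alpha)),
              U (S alpha) /\
                (forall z, U z ->
                   (singular_equilibrium g f1 (z, alpha) <-> z = S alpha)),
              simple_equilibrium g f1 f2 (E alpha, alpha),
              simple_singular_equilibrium g f1 f2 (S alpha, alpha) &
              (saddle g f1 f2 (E alpha, alpha) /\
                 folded_node g f1 f2 (S alpha, alpha)) \/
              (node g f1 f2 (E alpha, alpha) /\
                 folded_saddle g f1 f2 (S alpha, alpha))],
        E alpha @[alpha --> 0^'] --> ((0, 0) : R * R) &
        S alpha @[alpha --> 0^'] --> ((0, 0) : R * R)].
Proof.
have C1 (f : R * R * R -> R) : smooth f ->
    [/\ forall p, differentiable f p, continuous f,
        forall v, continuous (fun p => 'D_v f p) & Ck 1 f].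
  by move=> sf; have [df cf] := sf 1%N; split => //; exact: (sf 0%N).
have [dg cg cDg Cg] := C1 g smooth_g.
have [df1 cf1 cDf1 Cf1] := C1 f1 smooth_f1.
have [df2 cf2 cDf2 Cf2] := C1 f2 smooth_f2.
have sg := smooth_strict_diff0 Cg; have sf1 := smooth_strict_diff0 Cf1.
have sf2 := smooth_strict_diff0 Cf2.
(* [trE] and [trS] are the traces of the linearization where [f2], respectively [g], vanishes. The
   determinants there are [g * J2] and [f2 * Jg]. *)
pose J2 p := 'D_(dirx R) f1 p * 'D_(diry R) f2 p - 'D_(dirx R) f2 p * 'D_(diry R) f1 p.
pose Jg p := 'D_(dirx R) f1 p * 'D_(diry R) g p - 'D_(dirx R) g p * 'D_(diry R) f1 p.
pose trE p := 'D_(dirx R) f1 p + g p * 'D_(diry R) f2 p.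
pose trS p := 'D_(dirx R) f1 p + 'D_(diry R) g p * f2 p.
have J20 : J2 0 != 0 by move: det_f1f2; rewrite det_jacmx2 /J2 [X in _ - X]mulrC.
have Jg0 : Jg 0 != 0 by move: det_f1g; rewrite det_jacmx2 /Jg [X in _ - X]mulrC.
have cJ2 : continuous J2.
  by move=> p; apply: cvgB; apply: cvgM; [exact: cDf1|exact: cDf2|exact: cDf2|exact: cDf1].
have cJg : continuous Jg.
  by move=> p; apply: cvgB; apply: cvgM; [exact: cDf1|exact: cDg|exact: cDg|exact: cDf1].
have ctrE : continuous trE.
  by move=> p; apply: cvgD; [exact: cDf1|apply: cvgM; [exact: cg|exact: cDf2]].
have ctrS : continuous trS.
  by move=> p; apply: cvgD; [exact: cDf1|apply: cvgM; [exact: cDg|exact: cf2]].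
have near_sign (h : R * R * R -> R) : continuous h -> h 0 != 0 ->
    \forall p \near (0 : R * R * R), 0 < h p * h 0.
  move=> ch h0; apply: (@continuous_near_gt0 _ _ (fun p => h p * h 0)).
    by move=> p; apply: cvgM; [exact: ch|exact: cvg_cst].
  by rewrite -expr2 exprn_even_gt0.
(* This is the discriminant for trace [t] and determinant [m * J]. As [m] vanishes at the origin,
   its value there is the square of the x-derivative of [f1]. *)
have near_disc (t m J : R * R * R -> R) :
    continuous t -> continuous m -> continuous J ->
    t 0 = 'D_(dirx R) f1 0 -> m 0 = 0 ->
    \forall p \near (0 : R * R * R), 0 < t p ^+ 2 - 4 * (m p * J p).
  move=> ct cm cJ t0 m0;
  apply: (@continuous_near_gt0 _ _ (fun p => t p ^+ 2 - 4 * (m p * J p))).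
    move=> p; apply: cvgB; first by apply: cvgM; exact: ct.
    by apply: cvgM; [exact: cvg_cst|apply: cvgM; [exact: cm|exact: cJ]].
  by rewrite m0 mul0r mulr0 subr0 t0 exprn_even_gt0.
have g0' : g 0 = 0 by [].
have f10' : f1 0 = 0 by [].
have f20' : f2 0 = 0 by [].
have trE0 : trE 0 = 'D_(dirx R) f1 0 by rewrite /trE g0' mul0r addr0.
have trS0 : trS 0 = 'D_(dirx R) f1 0 by rewrite /trS f20' mulr0 addr0.
(* On one common ball [J2], [Jg] and the x-derivative of [g] keep their signs and both discriminants
   are positive. *)
have [d d0 dP] := near_closed_ball (filterI (near_sign _ cJ2 J20)
  (filterI (near_sign _ cJg Jg0) (filterI (near_sign _ (cDg (dirx R)) gx)
  (filterI (near_disc trE g J2 ctrE cg cJ2 trE0 g0')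
   (near_disc trS f2 Jg ctrS cf2 cJg trS0 f20'))))).
have [r1 [K1 [E [r10 K10 EP]]]] := solve2 sf1 sf2 J20 cf1 cf2 f10' f20'.
have [r2 [K2 [S [r20 K20 SP]]]] := solve2 sf1 sg Jg0 cf1 cg f10' g0'.
pose D := \det (jacmx [tuple f1; f2; g] [tuple dirx R; diry R; dira R] 0).
have D0 : D != 0 by [].
have [dE dE0 signE] : exists2 dE, 0 < dE & forall z alpha,
    0 < `|alpha| -> `|alpha| <= dE -> `|z| <= K1 * `|alpha| ->
    f1 (z, alpha) = 0 -> f2 (z, alpha) = 0 -> 0 < J2 0 * g (z, alpha) * (D * alpha).
  by apply: cramer_sign sf1 sf2 sg f10' f20' g0' K10 (det_jacmx3 _ _ _ _ _ _ _) D0.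
(* Here [g] and [f2] exchange roles, which replaces [D] by [- D]; this is the source of the opposite
   types. *)
have [dS dS0 signS] : exists2 dS, 0 < dS & forall z alpha,
    0 < `|alpha| -> `|alpha| <= dS -> `|z| <= K2 * `|alpha| ->
    f1 (z, alpha) = 0 -> g (z, alpha) = 0 -> 0 < Jg 0 * f2 (z, alpha) * (- D * alpha).
  by apply: cramer_sign sf1 sg sf2 f10' g0' f20' K20 _ _;
    rewrite ?oppr_eq0// -det_jacmx3_swap det_jacmx3.
(* Both uniqueness statements hold in the ball of radius [r]. [M] dominates [K1], [K2] and 1, so M
   |alpha| bounds the plane coordinates of both solutions as well as |alpha| itself. *)
pose r := Num.min r1 r2; pose M := K1 + K2 + 1.
have M0 : 0 < M by rewrite !addr_gt0.
pose alpha0 := Num.min (Num.min r d / M) (Num.min dE dS).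
have alpha00 : 0 < alpha0 by rewrite !lt_min divr_gt0 ?lt_min ?r10 ?r20 ?d0 ?dE0.
have small (alpha : R) : `|alpha| < alpha0 -> [/\ M * `|alpha| <= r, M * `|alpha| <= d,
    `|alpha| <= dE & `|alpha| <= dS].
  rewrite !lt_min => /and3P[aM /ltW ? /ltW ?].
  by move: aM; rewrite ltr_pdivlMr// mulrC lt_min => /andP[/ltW ? /ltW ?].
have K1M : K1 <= M by rewrite /M -addrA lerDl addr_ge0// ltW.
have K2M : K2 <= M by rewrite /M addrAC lerDr addr_ge0// ltW.
have EK (alpha : R) : `|alpha| < alpha0 -> K1 * `|alpha| <= r.
  by move=> /small[aM _ _ _]; rewrite (le_trans _ aM)// ler_wpM2r.
have SK (alpha : R) : `|alpha| < alpha0 -> K2 * `|alpha| <= r.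
  by move=> /small[aM _ _ _]; rewrite (le_trans _ aM)// ler_wpM2r.
have rr1 : r <= r1 by rewrite ge_min lexx.
have rr2 : r <= r2 by rewrite ge_min lexx orbT.
have M1 : 1 <= M by rewrite /M lerDr addr_ge0// ltW.
have in_d K (z : R * R) (alpha : R) : K <= M -> `|alpha| < alpha0 ->
    `|z| <= K * `|alpha| -> `|(z, alpha)| <= d.
  move=> KM /small[_ aM _ _] zK; rewrite prod_normE ge_max /= !(le_trans _ aM)//.
    by rewrite ler_peMl.
  by rewrite (le_trans zK)// ler_wpM2r.
exists [set z | `|z| <= r], alpha0, E, S; split => //.
- by apply: (@nbhs0_le R (R * R)%type r); rewrite lt_min r10.
- move=> alpha /andP[a0 aa0]; have [_ _ adE adS] := small alpha aa0.
  have [EK1 Ef1 Ef2 Euniq] := EP alpha (le_trans (EK _ aa0) rr1).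
  have [SK2 Sf1 Sg Suniq] := SP alpha (le_trans (SK _ aa0) rr2).
  have sE := signE _ _ a0 adE EK1 Ef1 Ef2.
  have sS := signS _ _ a0 adS SK2 Sf1 Sg.
  have [J2E [_ [_ [discE _]]]] := dP _ (in_d _ _ _ K1M aa0 EK1).
  have [_ [JgS [gxS [_ discS]]]] := dP _ (in_d _ _ _ K2M aa0 SK2).
  have gE : g (E alpha, alpha) != 0.
    by apply: contraTneq sE => ->; rewrite mulr0 mul0r ltxx.
  have f2S : f2 (S alpha, alpha) != 0.
    by apply: contraTneq sS => ->; rewrite mulr0 mul0r ltxx.
  have eqE : equilibrium g f1 f2 (E alpha, alpha) by [].
  have eqS : singular_equilibrium g f1 (S alpha, alpha) by [].
  (* The determinant at the equilibrium has the sign of [D * alpha], the one at the singular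
     equilibrium the opposite sign. *)
  have detE := mulr_gt0_cancel J2E sE; have detS := mulr_gt0_cancel JgS sS.
  have := linearization_EQ (df2 _) (dg _) eqE => linE.
  have := linearization_sEQ (df2 _) (dg _) eqS => linS.
  have trEE : \tr (linearization g f1 f2 (E alpha, alpha)) = trE (E alpha, alpha).
    by rewrite linE tr_mx22.
  have trSS : \tr (linearization g f1 f2 (S alpha, alpha)) = trS (S alpha, alpha).
    by rewrite linS tr_mx22.
  have detEE : \det (linearization g f1 f2 (E alpha, alpha)) =
      g (E alpha, alpha) * J2 (E alpha, alpha).
    rewrite linE det_mx22 /J2.
    move: ('D_(dirx R) f1 _) ('D_(diry R) f1 _) ('D_(dirx R) f2 _) ('D_(diry R) f2 _).
    by move=> *; ring.
  have detSS : \det (linearization g f1 f2 (S alpha, alpha)) =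
      f2 (S alpha, alpha) * Jg (S alpha, alpha).
    rewrite linS det_mx22 /Jg.
    move: ('D_(dirx R) f1 _) ('D_(diry R) f1 _) ('D_(dirx R) g _) ('D_(diry R) g _).
    by move=> *; ring.
  have [||simpE saddleE nodeE] := equilibrium_type eqE.
  - by rewrite trEE detEE ltW.
  - by rewrite detEE; apply: contraTneq detE => ->; rewrite mul0r ltxx.
  have [|||| simpS saddleS nodeS] := singular_equilibrium_type eqS f2S.
  - by apply: contraTneq gxS => ->; rewrite mul0r ltxx.
  - rewrite det_jacmx2 [X in _ - X]mulrC -/(Jg _).
    by apply: contraTneq JgS => ->; rewrite mul0r ltxx.
  - by rewrite trSS detSS ltW.
  - by rewrite detSS; apply: contraTneq detS => ->; rewrite mul0r ltxx.
  split => //.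
  - split; first exact: le_trans EK1 (EK _ aa0).
    move=> z zr; split => [[zf1 zf2 _]|-> //].
    by apply: Euniq => //; exact: le_trans zr rr1.
  - split; first exact: le_trans SK2 (SK _ aa0).
    move=> z zr; split => [[zg zf1]|-> //].
    by apply: Suniq => //; exact: le_trans zr rr2.
  (* Negative [D * alpha] gives a saddle and a folded node, positive a node and a folded saddle;
     zero contradicts [sE]. *)
  have [Da|Da|Da] := ltgtP (D * alpha) 0.
  - left; split; [apply: saddleE|apply: nodeS].
      by rewrite detEE; move: detE; rewrite nmulr_lgt0.
    by rewrite detSS; move: detS; rewrite mulNr pmulr_lgt0 // oppr_gt0.
  - right; split; [apply: nodeE|apply: saddleS].
      by rewrite detEE; move: detE; rewrite pmulr_lgt0.
    by rewrite detSS; move: detS; rewrite mulNr nmulr_lgt0 // oppr_lt0.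
  - by move: sE; rewrite Da mulr0 ltxx.
- apply: (cvg_linear_bound K10 alpha00) => alpha /andP[_ aa0].
  by have [] := EP alpha (le_trans (EK _ aa0) rr1).
- apply: (cvg_linear_bound K20 alpha00) => alpha /andP[_ aa0].
  by have [] := SP alpha (le_trans (SK _ aa0) rr2).
Qed.
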